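(* Let $\nu\ge0$. For each $\lambda\in(1/2,2)$ there exists a value $\mathcal C_\nu^{(I)}(\lambda)>0$ such that $$\mathcal U_\nu^{(I)}(\lambda,x)=\frac1x\left(\nu-\lambda+\sqrt{(\nu+\lambda)^2+\mathcal C_\nu^{(I)}(\lambda)\,x^2}\right)$$ satisfies $$h_\nu(x)=\frac{I_{\nu-1}(x)}{I_\nu(x)}\le\mathcal U_\nu^{(I)}(\lambda,x),\qquad x>0,$$ where, for fixed $\nu$ and $\lambda$, the equality holds at one and only one value of the variable $x_*=x_\nu^{(I)}(\lambda)>0$, where $h_\nu'(x_* )=\mathcal U_\nu^{(I)\prime}(\lambda,x_* )$. As a function of $\lambda$, $\mathcal C_\nu^{(I)}(\lambda)$ is increasing while $x_\nu^{(I)}(\lambda)$ is decreasing, and the following limits hold: $$\lim_{\lambda\to1/2}\mathcal C_\nu^{(I)}(\lambda)=1,\qquad \lim_{\lambda\to2}\mathcal C_\nu^{(I)}(\lambda)=\frac{\nu+2}{\nu+1},$$ $$\lim_{\lambda\to1/2}x_\nu^{(I)}(\lambda)=+\infty,\qquad \lim_{\lambda\to2}x_\nu^{(I)}(\lambda)=0.$$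
   Context: $I_\nu$ denotes the modified Bessel function of the first kind of real order $\nu$. Primes denote derivatives with respect to $x$. Limits in $\lambda$ are taken through $\lambda\in(1/2,2)$. *)

(* Defs.v *)
(* Stdlib reals with Coquelicot. *)
From Stdlib Require Import Reals Factorial Lra.
From Coquelicot Require Import Coquelicot.
Open Scope R_scope.

(* The reciprocal Gamma function, by the Euler-Gauss limit
     1 / Gamma z = lim_n  z (z + 1) ... (z + n) / (n! n^z),
   which converges for every real z and vanishes at the poles 0, -1, -2, ...
   of Gamma.  Orders nu - 1 down to -1 occur below, so these poles matter. *)
Definition rGamma (z : R) : R :=
  real (Lim_seq (fun n : nat =>
    prod_f_R0 (fun j : nat => z + INR j) n / (INR (fact n) * Rpower (INR n) z))).

(* I_nu(x) = (x/2)^nu * sum_k (x^2/4)^k / (k! Gamma(nu + k + 1)).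
   Meaningful for x > 0 only, because of Rpower. *)
Definition besselI (nu x : R) : R :=
  Rpower (x / 2) nu *
  PSeries (fun k : nat => rGamma (nu + INR k + 1) / INR (fact k)) ((x / 2) ^ 2).

Definition hI (nu x : R) : R := besselI (nu - 1) x / besselI nu x.

(* [c] is the value of the coefficient C_nu^(I)(lam). *)
Definition UI (nu c lam x : R) : R :=
  1 / x * (nu - lam + sqrt ((nu + lam) ^ 2 + c * x ^ 2)).

(* Main.v *)
Require Import Defs.
From Stdlib Require Import Reals Ranalysis5 Lra Factorial ClassicalEpsilon.
From Coquelicot Require Import Coquelicot.
Open Scope R_scope.

(** Put [u = x^2/4] and [S_nu(u) = sum_k u^k / (k! Gamma(nu+k+1))], so that
    [I_nu(x) = (x/2)^nu S_nu(u)].  Since [S_nu' = S_(nu+1)] and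
    [S_(nu-1) = nu S_nu + u S_(nu+1)], the ratio [g = S_(nu+1) / S_nu] gives
    [x h_nu(x) = 2 (nu + u g(u))], and squaring turns the bound [h_nu <= U] with
    coefficient [c] into [F_lam(u) <= c], where
    [F_lam(u) = g (u g + nu + lam)] ([profile]).  The theorem says that
    [F_lam] has exactly one maximizer [u_star] on [(0, oo)]; then
    [C(lam) = F_lam(u_star)] and [x_star = 2 sqrt u_star].

    The recurrences make [g] a solution of a Riccati equation.  With
    [T = - g'] ([turan], because [T > 0] is a Turan inequality),
    [u T = u g^2 + (nu+1) g - 1], and a computation gives
    [F_lam' = T (L - lam)] with [L = g^2 / T - 2 u g - nu] ([criticalParam]).
    Hence everything reduces to showing that [L] decreases strictly from
    [L(0) = 2] to the limit [1/2]: then [u_star(lam)] is the inverse of [L], it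
    is decreasing, and [F_lam] increases before it and decreases after it.

    Monotonicity of [L] comes from a closed planar system.  With
    [z = u T / g] ([relTuran]), which lies in [(0, 1)],
      [u L' = (g^2 / T) (2 (1 - z)^2 - L)]  and  [u z' = z (L - 1 + z)].
    So [L' < 0] means that [M = L - 2 (1 - z)^2] is positive.  At a zero of
    [M] one has [L' = 0], [0 < L], hence [z < 1/2], and
    [u M' = 4 z (1 - z)^2 (1 - 2 z) > 0]: zeros of [M] are crossed upwards
    only, so [M] stays positive once it is.  If [M(u1) <= 0], then [M <= 0] on
    all of [(0, u1]], so [L] is nondecreasing there and [L(u1) >= L(0) = 2];
    but [M(u1) <= 0] forces [L(u1) <= 2 (1 - z)^2 < 2]
    ([criticalParam_above_nullcline]).  The inequalities [T > 0] and [z < 1]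
    follow from the same [barrier] principle.

    The limits of [C] need no asymptotic expansion of [g]:
    [F_lam(0) < C(lam) < F_2(0)] handles [lam -> 2], and
    [1 + (lam-1) g <= F_lam <= 1 + lam g] with [g -> 0] handles
    [lam -> 1/2]. *)

(** * The reciprocal Gamma function as a limit of the Gauss sequence *)

Lemma ln_le_sub_1 (x : R) : 0 < x -> ln x <= x - 1.
Proof.
  intros hx; pose proof (exp_ineq1_le (ln x)) as h.
  rewrite exp_ln in h by exact hx; lra.
Qed.

Lemma ln_ge_1_sub_inv (x : R) : 0 < x -> 1 - / x <= ln x.
Proof.
  intros hx; pose proof (ln_le_sub_1 (/ x) (Rinv_0_lt_compat x hx)) as h.
  rewrite ln_Rinv in h by exact hx; lra.
Qed.

Definition gaussSeq (z : R) (n : nat) : R :=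
  prod_f_R0 (fun j => z + INR j) n / (INR (fact n) * Rpower (INR n) z).

Lemma prod_shift_pos (z : R) (n : nat) :
  0 < z -> 0 < prod_f_R0 (fun j => z + INR j) n.
Proof.
  intros hz; induction n as [|n IH]; [simpl; lra|].
  change (0 < prod_f_R0 (fun j => z + INR j) n * (z + INR (S n))).
  apply Rmult_lt_0_compat; [exact IH | pose proof (pos_INR (S n)); lra].
Qed.

(** The step factor with arbitrary bases [b] and [c] in place of [n] and
    [n + 1]: the Gauss sequence and its lower companion in [gaussSeq_lower]
    differ only in these bases. *)
Lemma shifted_gauss_step (z b c : R) (n : nat) :
  prod_f_R0 (fun j => z + INR j) (S n) / (INR (fact (S n)) * Rpower c z) =
  prod_f_R0 (fun j => z + INR j) n / (INR (fact n) * Rpower b z) *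
  ((z + INR (S n)) / INR (S n) * exp (z * (ln b - ln c))).
Proof.
  change (prod_f_R0 (fun j => z + INR j) (S n))
    with (prod_f_R0 (fun j => z + INR j) n * (z + INR (S n))).
  rewrite fact_simpl, mult_INR.
  replace (exp (z * (ln b - ln c))) with (Rpower b z / Rpower c z).
  2:{ unfold Rpower, Rdiv; rewrite <- exp_Ropp, <- exp_plus; f_equal; ring. }
  pose proof (INR_fact_lt_0 n); pose proof (lt_0_INR (S n) ltac:(apply Nat.lt_0_succ)).
  assert (0 < Rpower b z) by apply exp_pos.
  assert (0 < Rpower c z) by apply exp_pos.
  field; repeat split; lra.
Qed.

Lemma gaussSeq_pos (z : R) (n : nat) : 0 < z -> 0 < gaussSeq z n.
Proof.
  intros hz; apply Rdiv_lt_0_compat; [now apply prod_shift_pos|].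
  apply Rmult_lt_0_compat; [apply INR_fact_lt_0 | apply exp_pos].
Qed.

(** With [m = n + 1], the step factor [(1 + z/(m+1)) (m/(m+1))^z] is at most
    [exp (z/(m+1)) exp (- z/(m+1)) = 1]. *)
Lemma gaussSeq_decr (z : R) (n : nat) :
  0 < z -> gaussSeq z (S (S n)) <= gaussSeq z (S n).
Proof.
  intros hz; unfold gaussSeq at 1.
  rewrite (shifted_gauss_step z (INR (S n)) (INR (S (S n)))).
  fold (gaussSeq z (S n)).
  rewrite <- (Rmult_1_r (gaussSeq z (S n))) at 2.
  apply Rmult_le_compat_l; [left; now apply gaussSeq_pos|].
  assert (hm : 0 < INR (S n)) by (apply lt_0_INR, Nat.lt_0_succ).
  rewrite (S_INR (S n)); set (m := INR (S n)) in *.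
  pose proof (exp_ineq1_le (z / (m + 1))) as h1.
  assert (h2 : ln m - ln (m + 1) <= - / (m + 1)).
  { rewrite <- ln_div by lra.
    eapply Rle_trans; [apply ln_le_sub_1, Rdiv_lt_0_compat; lra|].
    right; field; lra. }
  apply Rle_trans with (exp (z / (m + 1)) * exp (z * - / (m + 1)));[|right].
  2:{ rewrite <- exp_plus; replace (_ + _) with 0 by (field; lra); apply exp_0. }
  apply Rmult_le_compat; [|left; apply exp_pos| |].
  - left; apply Rdiv_lt_0_compat; lra.
  - eapply Rle_trans; [|exact h1]; right; field; lra.
  - destruct (Rle_lt_or_eq_dec _ _ (Rmult_le_compat_l z _ _ (Rlt_le _ _ hz) h2)) as [h|h].
    + left; now apply exp_increasing.
    + rewrite h; right; reflexivity.
Qed.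

(** The limit of a decreasing positive sequence could still vanish.  Replacing
    [n^z] by the larger [(n + 1 + z)^z] gives a sequence below the Gauss
    sequence whose step factor is at least 1, since, with [m = n + 1],
    [ln (1 + z/m) >= z / (m + z) >= z ln ((m + 1 + z) / (m + z))]; its first
    term is the bound. *)
Lemma gaussSeq_lower (z : R) (n : nat) :
  0 < z -> z / Rpower (1 + z) z <= gaussSeq z (S n).
Proof.
  intros hz.
  assert (h : forall k, z / Rpower (1 + z) z <=
     prod_f_R0 (fun j => z + INR j) k / (INR (fact k) * Rpower (INR k + 1 + z) z)).
  { induction k as [|k IH].
    { simpl; right; rewrite Rplus_0_l, Rplus_0_r, Rmult_1_l; reflexivity. }
    rewrite (shifted_gauss_step z (INR k + 1 + z)).
    eapply Rle_trans; [exact IH|].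
    set (p := _ / _ : R).
    rewrite <- (Rmult_1_r p) at 1; apply Rmult_le_compat_l.
    { left; apply Rdiv_lt_0_compat; [now apply prod_shift_pos|].
      apply Rmult_lt_0_compat; [apply INR_fact_lt_0 | apply exp_pos]. }
    assert (hm : 0 < INR (S k)) by (apply lt_0_INR, Nat.lt_0_succ).
    rewrite <- S_INR; set (m := INR (S k)) in *.
    assert (hq : 0 < (z + m) / m) by (apply Rdiv_lt_0_compat; lra).
    rewrite <- (exp_ln _ hq), <- exp_plus.
    assert (0 <= ln ((z + m) / m) + z * (ln (m + z) - ln (m + 1 + z))).
    { pose proof (ln_ge_1_sub_inv _ hq) as h1.
      replace (1 - / ((z + m) / m)) with (z * / (m + z)) in h1 by (field; lra).
      assert (h2 : - / (m + z) <= ln (m + z) - ln (m + 1 + z)).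
      { rewrite <- ln_div by lra.
        eapply Rle_trans; [|apply ln_ge_1_sub_inv, Rdiv_lt_0_compat; lra].
        right; field; lra. }
      pose proof (Rmult_le_compat_l z _ _ (Rlt_le _ _ hz) h2); lra. }
    pose proof (exp_ineq1_le (ln ((z + m) / m) + z * (ln (m + z) - ln (m + 1 + z)))).
    lra. }
  eapply Rle_trans; [apply (h (S n))|].
  unfold gaussSeq, Rdiv; apply Rmult_le_compat_l.
  { left; now apply prod_shift_pos. }
  assert (hm : 0 < INR (S n)) by (apply lt_0_INR, Nat.lt_0_succ).
  pose proof (INR_fact_lt_0 (S n)).
  apply Rinv_le_contravar.
  { apply Rmult_lt_0_compat; [assumption | apply exp_pos]. }
  apply Rmult_le_compat_l; [lra|].
  apply Rle_Rpower_l; lra.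
Qed.

Lemma is_lim_rGamma (z : R) : 0 < z -> is_lim_seq (gaussSeq z) (rGamma z).
Proof.
  intros hz.
  assert (hex : ex_finite_lim_seq (gaussSeq z)).
  { destruct (ex_finite_lim_seq_decr (fun n => gaussSeq z (S n)) 0) as [l hl].
    - intros n; now apply gaussSeq_decr.
    - intros n; left; now apply gaussSeq_pos.
    - exists l; now apply is_lim_seq_incr_1. }
  change (rGamma z) with (real (Lim_seq (gaussSeq z))).
  now apply Lim_seq_correct'.
Qed.

Lemma rGamma_pos (z : R) : 0 < z -> 0 < rGamma z.
Proof.
  intros hz; apply Rlt_le_trans with (z / Rpower (1 + z) z).
  { apply Rdiv_lt_0_compat; [exact hz | apply exp_pos]. }
  pose proof (is_lim_rGamma z hz) as h; apply is_lim_seq_incr_1 in h.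
  refine (is_lim_seq_le _ _ (Finite _) (Finite _) _ (is_lim_seq_const _) h).
  intros n; now apply gaussSeq_lower.
Qed.

Lemma prod_shift_succ (z : R) (n : nat) :
  prod_f_R0 (fun j => z + INR j) n * (z + INR n + 1) =
  z * prod_f_R0 (fun j => z + 1 + INR j) n.
Proof.
  induction n as [|n IH]; [simpl; ring|].
  change (prod_f_R0 (fun j => z + INR j) (S n))
    with (prod_f_R0 (fun j => z + INR j) n * (z + INR (S n))).
  change (prod_f_R0 (fun j => z + 1 + INR j) (S n))
    with (prod_f_R0 (fun j => z + 1 + INR j) n * (z + 1 + INR (S n))).
  rewrite <- Rmult_assoc, <- IH, S_INR; ring.
Qed.

(** At [z = 0] this gives the zero of the reciprocal Gamma function, which the
    order [nu - 1 = -1] requires. *)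
Lemma rGamma_succ (z : R) : 0 <= z -> rGamma z = z * rGamma (z + 1).
Proof.
  intros hz.
  assert (h : is_lim_seq (gaussSeq z) (z * rGamma (z + 1))).
  { apply is_lim_seq_incr_1.
    apply (is_lim_seq_ext
      (fun n => z * gaussSeq (z + 1) (S n) * (1 - (z + 1) * / (INR (S n) + (z + 1))))).
    { intros n; unfold gaussSeq.
      assert (hm : 0 < INR (S n)) by (apply lt_0_INR, Nat.lt_0_succ).
      pose proof (prod_shift_succ z (S n)) as e.
      set (m := INR (S n)) in *.
      replace (prod_f_R0 (fun j => z + INR j) (S n)) with
        (z * prod_f_R0 (fun j => z + 1 + INR j) (S n) / (z + m + 1)).
      2:{ rewrite <- e; field; lra. }
      rewrite Rpower_plus, Rpower_1 by exact hm.
      pose proof (INR_fact_lt_0 (S n)).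
      assert (0 < Rpower m z) by apply exp_pos.
      field; repeat split; lra. }
    replace (Finite (z * rGamma (z + 1)))
      with (Finite (z * rGamma (z + 1) * (1 - (z + 1) * 0))) by (f_equal; ring).
    apply is_lim_seq_mult'.
    - apply (is_lim_seq_scal_l _ z (Finite (rGamma (z + 1)))).
      apply -> is_lim_seq_incr_1; apply is_lim_rGamma; lra.
    - apply is_lim_seq_minus'; [apply is_lim_seq_const|].
      apply (is_lim_seq_scal_l _ (z + 1) (Finite 0)).
      apply (is_lim_seq_inv _ p_infty); [|discriminate].
      apply (is_lim_seq_plus _ _ p_infty (z + 1) p_infty);
        [apply -> is_lim_seq_incr_1; apply is_lim_seq_INR
        | apply is_lim_seq_const | reflexivity]. }
  apply is_lim_seq_unique in h.
  change (rGamma z) with (real (Lim_seq (gaussSeq z))).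
  now rewrite h.
Qed.

(** * The power series of the Bessel functions *)

Definition besselCoef (nu : R) (k : nat) : R :=
  rGamma (nu + INR k + 1) / INR (fact k).

Definition besselSum (nu u : R) : R := PSeries (besselCoef nu) u.

Lemma besselCoef_pos (nu : R) (k : nat) : 0 <= nu -> 0 < besselCoef nu k.
Proof.
  intros hnu; apply Rdiv_lt_0_compat; [|apply INR_fact_lt_0].
  apply rGamma_pos; pose proof (pos_INR k); lra.
Qed.

Lemma besselCoef_succ (nu : R) (k : nat) : 0 <= nu ->
  besselCoef nu k = INR (S k) * (nu + 1 + INR k) * besselCoef nu (S k).
Proof.
  intros hnu; unfold besselCoef.
  rewrite (rGamma_succ (nu + INR k + 1)) by (pose proof (pos_INR k); lra).
  rewrite fact_simpl, mult_INR, S_INR.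
  replace (nu + (INR k + 1) + 1) with (nu + INR k + 1 + 1) by ring.
  pose proof (INR_fact_neq_0 k); pose proof (pos_INR k).
  field; split; lra.
Qed.

(** All derivatives of the series thus stay within the family [besselSum]. *)
Lemma PS_derive_besselCoef (nu : R) (k : nat) :
  PS_derive (besselCoef nu) k = besselCoef (nu + 1) k.
Proof.
  unfold PS_derive, besselCoef; rewrite fact_simpl, mult_INR, S_INR.
  replace (nu + (INR k + 1) + 1) with (nu + 1 + INR k + 1) by ring.
  pose proof (INR_fact_neq_0 k); pose proof (pos_INR k).
  field; split; lra.
Qed.

Lemma besselCoef_pred (nu : R) (k : nat) : 0 <= nu ->
  besselCoef (nu - 1) k = (nu + INR k) * besselCoef nu k.
Proof.
  intros hnu; unfold besselCoef.
  replace (nu - 1 + INR k + 1) with (nu + INR k) by ring.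
  rewrite (rGamma_succ (nu + INR k)) by (pose proof (pos_INR k); lra).
  pose proof (INR_fact_neq_0 k); field; lra.
Qed.

Lemma CV_radius_besselCoef (nu : R) : 0 <= nu ->
  CV_radius (besselCoef nu) = p_infty.
Proof.
  intros hnu; apply CV_radius_infinite_DAlembert.
  { intros k; pose proof (besselCoef_pos nu k hnu); lra. }
  apply (is_lim_seq_le_le (fun _ => 0) _ (fun k => / INR (S k))).
  - intros k; split; [apply Rabs_pos|].
    pose proof (besselCoef_pos nu (S k) hnu); pose proof (pos_INR k).
    rewrite (besselCoef_succ nu k hnu), S_INR.
    rewrite Rabs_pos_eq.
    + apply Rle_trans with (/ (INR k + 1) * / (nu + 1 + INR k)).
      * right; field; repeat split; lra.
      * rewrite <- (Rmult_1_r (/ (INR k + 1))) at 2.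
        apply Rmult_le_compat_l; [left; apply Rinv_0_lt_compat; lra|].
        apply Rle_trans with (/ 1); [apply Rinv_le_contravar; lra | rewrite Rinv_1; lra].
    + left; apply Rdiv_lt_0_compat; [assumption|].
      apply Rmult_lt_0_compat; [apply Rmult_lt_0_compat; lra | assumption].
  - apply is_lim_seq_const.
  - apply (is_lim_seq_inv _ p_infty); [|discriminate].
    apply -> is_lim_seq_incr_1; apply is_lim_seq_INR.
Qed.

Lemma is_derive_besselSum (nu u : R) : 0 <= nu ->
  is_derive (besselSum nu) u (besselSum (nu + 1) u).
Proof.
  intros hnu; unfold besselSum at 2.
  rewrite <- (PSeries_ext _ _ u (PS_derive_besselCoef nu)).
  apply is_derive_PSeries; rewrite (CV_radius_besselCoef nu hnu); exact I.
Qed.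

Lemma ex_pseries_besselCoef (nu u : R) : 0 <= nu -> ex_pseries (besselCoef nu) u.
Proof.
  intros hnu; apply CV_radius_inside; rewrite (CV_radius_besselCoef nu hnu); exact I.
Qed.

Lemma besselSum_rec (nu u : R) : 0 <= nu ->
  besselSum (nu - 1) u = nu * besselSum nu u + u * besselSum (nu + 1) u.
Proof.
  intros hnu; unfold besselSum.
  rewrite <- PSeries_incr_1.
  rewrite <- PSeries_scal.
  rewrite <- PSeries_plus.
  - apply PSeries_ext; intros k; rewrite (besselCoef_pred nu k hnu).
    unfold PS_plus, PS_scal, PS_incr_1, plus, scal; simpl; unfold mult; simpl.
    destruct k as [|k]; [simpl; unfold zero; simpl; ring|].
    rewrite <- PS_derive_besselCoef; unfold PS_derive; ring.
  - apply ex_pseries_scal; [apply Rmult_comm | now apply ex_pseries_besselCoef].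
  - apply ex_pseries_incr_1, ex_pseries_besselCoef; lra.
Qed.

Lemma besselSum_pos (nu u : R) : 0 <= nu -> 0 <= u -> 0 < besselSum nu u.
Proof.
  intros hnu hu.
  assert (hex : ex_series (fun k => besselCoef nu k * u ^ k)).
  { apply ex_pseries_R, ex_pseries_besselCoef, hnu. }
  change (0 < Series (fun k => besselCoef nu k * u ^ k)).
  rewrite Series_incr_1 by exact hex.
  assert (h : 0 <= Series (fun k => besselCoef nu (S k) * u ^ S k)).
  { set (b := fun k => besselCoef nu (S k) * u ^ S k).
    replace 0 with (Series (fun k => 0 * b k)) by (rewrite Series_scal_l; ring).
    assert (hb : forall k, 0 <= b k).
    { intros k; apply Rmult_le_pos; [left; now apply besselCoef_pos | now apply pow_le]. }
    apply Series_le; [intros k; specialize (hb k); lra|].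
    now apply (ex_series_incr_1 (fun k => besselCoef nu k * u ^ k)). }
  pose proof (besselCoef_pos nu 0 hnu); rewrite pow_O; lra.
Qed.

Lemma besselSum_0_succ (nu : R) : 0 <= nu ->
  besselSum nu 0 = (nu + 1) * besselSum (nu + 1) 0.
Proof.
  intros hnu; pose proof (besselSum_rec (nu + 1) 0 ltac:(lra)) as h.
  replace (nu + 1 - 1) with nu in h by ring; lra.
Qed.

Lemma hI_besselSum (nu x : R) : 0 < x ->
  hI nu x = 2 / x * (besselSum (nu - 1) ((x / 2) ^ 2) / besselSum nu ((x / 2) ^ 2)).
Proof.
  intros hx; unfold hI.
  change (besselI (nu - 1) x) with
    (Rpower (x / 2) (nu - 1) * besselSum (nu - 1) ((x / 2) ^ 2)).
  change (besselI nu x) with (Rpower (x / 2) nu * besselSum nu ((x / 2) ^ 2)).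
  replace (Rpower (x / 2) nu) with (Rpower (x / 2) (nu - 1) * (x / 2)).
  2:{ rewrite <- (Rpower_1 (x / 2)) at 2 by lra.
      rewrite <- Rpower_plus; f_equal; ring. }
  assert (0 < Rpower (x / 2) (nu - 1)) by apply exp_pos.
  unfold Rdiv; rewrite !Rinv_mult.
  fold (x / 2).
  generalize (/ besselSum nu ((x / 2) ^ 2)); intros b.
  field; lra.
Qed.

(** * Calculus tools *)

Lemma is_derive_cont (f : R -> R) (x l : R) : is_derive f x l -> continuity_pt f x.
Proof.
  intros h; apply derivable_continuous_pt; exists l; now apply is_derive_Reals.
Qed.

Lemma Derive_of_is_derive (f : R -> R) (x l : R) :
  is_derive f x l -> Derive (fun t : R => f t) x = l.
Proof. apply is_derive_unique. Qed.

(** Differentiability is needed in the open interval only, since several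
    functions below have a known derivative only away from the endpoint 0. *)
Lemma mean_value (f df : R -> R) (a b : R) : a < b ->
  (forall c, a <= c <= b -> continuity_pt f c) ->
  (forall c, a < c < b -> is_derive f c (df c)) ->
  exists c, a < c < b /\ f b - f a = df c * (b - a).
Proof.
  intros hab hc hd.
  assert (pr : forall c, a < c < b -> derivable_pt f c).
  { intros c h; exists (df c); now apply is_derive_Reals, hd. }
  destruct (MVT f id a b pr (fun c _ => derivable_pt_id c) hab hc
     (fun c _ => derivable_continuous_pt _ _ (derivable_pt_id c))) as [c [hcc e]].
  exists c; split; [exact hcc|].
  rewrite derive_pt_id, Rmult_1_r in e.
  rewrite Derive_Reals, (is_derive_unique _ _ _ (hd c hcc)) in e.
  unfold id in e; lra.
Qed.

Lemma neg_before_increasing_zero (f : R -> R) (x l : R) : is_derive f x l -> 0 < l -> f x = 0 ->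
  exists d, 0 < d /\ forall t, x - d < t < x -> f t < 0.
Proof.
  intros hd hl h0; apply is_derive_Reals in hd.
  destruct (hd (l / 2) ltac:(lra)) as [d hd'].
  exists d; split; [apply cond_pos|].
  intros t ht.
  specialize (hd' (t - x) ltac:(lra) ltac:(rewrite Rabs_left; lra)).
  replace (x + (t - x)) with t in hd' by ring.
  rewrite h0, Rminus_0_r in hd'.
  apply Rabs_def2 in hd'.
  assert (hq : 0 < f t / (t - x)) by lra.
  replace (f t) with (- ((f t / (t - x)) * (x - t))) by (field; lra).
  pose proof (Rmult_lt_0_compat _ (x - t) hq ltac:(lra)); lra.
Qed.

Lemma continuity_pt_sign (f : R -> R) (x : R) : continuity_pt f x -> f x <> 0 ->
  exists d, 0 < d /\ forall t, Rabs (t - x) < d -> 0 < f t * f x.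
Proof.
  intros hc hx.
  destruct (hc (Rabs (f x)) (Rabs_pos_lt _ hx)) as [d [hd h]].
  exists d; split; [exact hd|]; intros t ht.
  destruct (Req_dec t x) as [->|ne]; [nra|].
  assert (h' : Rabs (f t - f x) < Rabs (f x)).
  { apply h; split; [split; [exact I | congruence] | exact ht]. }
  apply Rabs_def2 in h'.
  destruct (Rcase_abs (f x)) as [hn|hp].
  - rewrite Rabs_left in h' by exact hn; nra.
  - rewrite Rabs_right in h' by exact hp; assert (0 < f x) by lra; nra.
Qed.

(** A function all of whose zeros are crossed upwards cannot leave the positive
    half-line: at its first zero it would be positive just before, against
    [neg_before_increasing_zero]. *)
Lemma barrier (f df : R -> R) (a : R) : 0 < f a ->
  (forall t, a <= t -> continuity_pt f t) ->
  (forall t, a < t -> f t = 0 -> is_derive f t (df t) /\ 0 < df t) ->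
  forall t, a <= t -> 0 < f t.
Proof.
  intros ha hc hd b hb.
  destruct (Rlt_le_dec 0 (f b)) as [h|hfb]; [exact h|exfalso].
  (* The supremum [m] of [E] is the first point where [f] fails to be positive. *)
  set (E := fun x => a <= x <= b /\ forall t, a <= t <= x -> 0 < f t).
  assert (Ea : E a) by (split; [lra|]; intros t ht; replace t with a by lra; exact ha).
  destruct (completeness E) as [m [hub hlub]].
  { exists b; intros x [hx _]; lra. }
  { now exists a. }
  assert (hm : a <= m <= b) by (split; [now apply hub | apply hlub; intros x [hx _]; lra]).
  assert (hpos : forall t, a <= t < m -> 0 < f t).
  { intros t ht; destruct (Rlt_le_dec 0 (f t)) as [h|h]; [exact h|exfalso].
    apply (Rlt_irrefl m), Rle_lt_trans with t; [|lra].
    apply hlub; intros x [hx hx'].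
    destruct (Rle_lt_dec x t) as [hxt|hxt]; [exact hxt|exfalso].
    specialize (hx' t ltac:(lra)); lra. }
  destruct (Req_dec (f m) 0) as [hz|hz].
  - assert (ham : a < m) by (destruct (Req_dec a m); [subst; lra | lra]).
    destruct (hd m ham hz) as [hder hdf].
    destruct (neg_before_increasing_zero f m _ hder hdf hz) as [d [hd0 hlt]].
    pose proof (Rmax_l a (m - d)); pose proof (Rmax_r a (m - d)).
    pose proof (Rmax_lub_lt a (m - d) m ham ltac:(lra)).
    set (t := (Rmax a (m - d) + m) / 2).
    specialize (hlt t ltac:(unfold t; lra)); specialize (hpos t ltac:(unfold t; lra)); lra.
  - destruct (continuity_pt_sign f m (hc m ltac:(lra)) hz) as [d [hd0 hs]].
    destruct (Rlt_le_dec 0 (f m)) as [hp|hn].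
    + assert (hmb : m < b) by (destruct (Req_dec m b); [subst; lra | lra]).
      pose proof (Rmin_l b (m + d / 2)); pose proof (Rmin_r b (m + d / 2)).
      pose proof (Rmin_glb_lt b (m + d / 2) m hmb ltac:(lra)).
      set (t := Rmin b (m + d / 2)) in *.
      assert (Et : E t).
      { split; [lra|]; intros s hs'.
        destruct (Rlt_le_dec s m) as [hsm|hsm]; [apply hpos; lra|].
        assert (h1 : 0 < f s * f m) by (apply hs; rewrite Rabs_right; lra).
        nra. }
      specialize (hub t Et); lra.
    + assert (ham : a < m) by (destruct (Req_dec a m); [subst; lra | lra]).
      pose proof (Rmax_l a (m - d)); pose proof (Rmax_r a (m - d)).
      pose proof (Rmax_lub_lt a (m - d) m ham ltac:(lra)).
      set (t := (Rmax a (m - d) + m) / 2).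
      specialize (hpos t ltac:(unfold t; lra)).
      assert (h1 : 0 < f t * f m) by (apply hs; rewrite Rabs_left; unfold t; lra).
      nra.
Qed.

(** * The Riccati equation and the planar system *)

Definition besselRatio (nu u : R) : R := besselSum (nu + 1) u / besselSum nu u.

(** This is [(S_(nu+1)^2 - S_nu S_(nu+2)) / S_nu^2], a normalized Turan
    determinant, and equals [- g'].  Written with the series, it is
    meaningful and continuous at 0, unlike the expression given by the Riccati
    equation. *)
Definition turan (nu u : R) : R :=
  besselRatio nu u ^ 2 - besselSum (nu + 1 + 1) u / besselSum nu u.

(** The value of [lam] for which [u] is a critical point of
    [profile nu lam]. *)
Definition criticalParam (nu u : R) : R :=
  besselRatio nu u ^ 2 / turan nu u - 2 * u * besselRatio nu u - nu.

(** With [y = u g], this is the ratio [1 - u y' / y], which closes the system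
    for [criticalParam]. *)
Definition relTuran (nu u : R) : R := u * turan nu u / besselRatio nu u.

(** For [u > 0] and [lam > 0], the smallest coefficient [c] with
    [hI nu x <= UI nu c lam x] at the point [x = 2 sqrt u]. *)
Definition profile (nu lam u : R) : R :=
  besselRatio nu u * (u * besselRatio nu u + nu + lam).

Lemma besselRatio_pos (nu u : R) : 0 <= nu -> 0 <= u -> 0 < besselRatio nu u.
Proof. intros hnu hu; apply Rdiv_lt_0_compat; apply besselSum_pos; lra. Qed.

Lemma is_derive_besselRatio (nu u : R) : 0 <= nu -> 0 <= u ->
  is_derive (besselRatio nu) u (- turan nu u).
Proof.
  intros hnu hu; unfold turan, besselRatio.
  pose proof (besselSum_pos nu u hnu hu).
  evar_last.
  - apply is_derive_div; [apply is_derive_besselSum; lra.. | lra].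
  - unfold minus, plus, opp, mult, scal; simpl; field; lra.
Qed.

Lemma besselSum_rec_succ (nu u : R) : 0 <= nu ->
  besselSum nu u = (nu + 1) * besselSum (nu + 1) u + u * besselSum (nu + 1 + 1) u.
Proof.
  intros hnu; rewrite <- besselSum_rec by lra; f_equal; ring.
Qed.

Lemma turan_riccati (nu u : R) : 0 <= nu -> 0 <= u ->
  u * turan nu u = u * besselRatio nu u ^ 2 + (nu + 1) * besselRatio nu u - 1.
Proof.
  intros hnu hu; unfold turan, besselRatio.
  pose proof (besselSum_pos nu u hnu hu) as h0.
  pose proof (besselSum_rec_succ nu u hnu) as h.
  set (a := besselSum nu u) in *; set (b := besselSum (nu + 1) u) in *;
  set (c := besselSum (nu + 1 + 1) u) in *.
  replace (u * ((b / a) ^ 2 - c / a)) with (u * (b / a) ^ 2 - (u * c) / a) by (field; lra).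
  replace (u * c) with (a - (nu + 1) * b) by lra.
  field; lra.
Qed.

Lemma continuity_turan (nu u : R) : 0 <= nu -> 0 <= u -> continuity_pt (turan nu) u.
Proof.
  intros hnu hu.
  pose proof (besselSum_pos nu u hnu hu).
  apply (continuity_pt_minus (fun v => besselRatio nu v ^ 2)
    (fun v => besselSum (nu + 1 + 1) v / besselSum nu v)).
  - apply (continuity_pt_comp (besselRatio nu) (fun y => y ^ 2)).
    + eapply is_derive_cont, is_derive_besselRatio; assumption.
    + apply derivable_continuous_pt, derivable_pt_pow.
  - apply (continuity_pt_div (besselSum (nu + 1 + 1)) (besselSum nu));
      [eapply is_derive_cont, is_derive_besselSum; lra.. | lra].
Qed.

Lemma is_derive_turan (nu u : R) : 0 <= nu -> 0 < u ->
  is_derive (turan nu) u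
    ((besselRatio nu u ^ 2 - (2 * u * besselRatio nu u + nu + 2) * turan nu u) / u).
Proof.
  intros hnu hu.
  pose proof (besselSum_pos nu u hnu (Rlt_le _ _ hu)) as h0.
  pose proof (besselSum_rec_succ nu u hnu) as e1.
  pose proof (besselSum_rec_succ (nu + 1) u ltac:(lra)) as e2.
  unfold turan at 1.
  evar_last.
  - apply (is_derive_minus (fun v => besselRatio nu v ^ 2)
      (fun v => besselSum (nu + 1 + 1) v / besselSum nu v)).
    + apply is_derive_pow, is_derive_besselRatio; lra.
    + apply is_derive_div; [apply is_derive_besselSum; lra.. | lra].
  - unfold turan, besselRatio.
    set (a := besselSum nu u) in *; set (b := besselSum (nu + 1) u) in *;
    set (c := besselSum (nu + 1 + 1) u) in *; set (d := besselSum (nu + 1 + 1 + 1) u) in *.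
    replace d with ((b - (nu + 1 + 1) * c) / u) by (rewrite e2; field; lra).
    replace c with ((a - (nu + 1) * b) / u) by (rewrite e1; field; lra).
    unfold minus, plus, opp, mult, scal; simpl; field; lra.
Qed.

Lemma turan_0 (nu : R) : 0 <= nu -> turan nu 0 = / ((nu + 1) ^ 2 * (nu + 2)).
Proof.
  intros hnu; unfold turan, besselRatio.
  rewrite (besselSum_0_succ nu), (besselSum_0_succ (nu + 1)) by lra.
  pose proof (besselSum_pos (nu + 1 + 1) 0 ltac:(lra) ltac:(lra)).
  field; repeat split; lra.
Qed.

Lemma besselRatio_0 (nu : R) : 0 <= nu -> besselRatio nu 0 = / (nu + 1).
Proof.
  intros hnu; unfold besselRatio.
  rewrite (besselSum_0_succ nu) by lra.
  pose proof (besselSum_pos (nu + 1) 0 ltac:(lra) ltac:(lra)).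
  field; repeat split; lra.
Qed.

(** At a zero of [T], the equation
    [u T' = g^2 - (2 u g + nu + 2) T] reduces to [u T' = g^2 > 0]. *)
Lemma turan_pos (nu u : R) : 0 <= nu -> 0 <= u -> 0 < turan nu u.
Proof.
  intros hnu; revert u.
  apply (barrier _
    (fun u => (besselRatio nu u ^ 2 - (2 * u * besselRatio nu u + nu + 2) * turan nu u) / u)).
  - rewrite turan_0 by exact hnu; apply Rinv_0_lt_compat.
    apply Rmult_lt_0_compat; [apply pow_lt|]; lra.
  - intros t ht; now apply continuity_turan.
  - intros t ht e; split; [now apply is_derive_turan|].
    rewrite e, Rmult_0_r, Rminus_0_r.
    apply Rdiv_lt_0_compat; [apply pow_lt, besselRatio_pos; lra | exact ht].
Qed.

(** By the Riccati equation, [g - u T = 1 - nu g - u g^2]; at a zero of this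
    function, [g = u T] makes its derivative [T (nu + u^2 T) > 0]. *)
Lemma turan_lt_ratio (nu u : R) : 0 <= nu -> 0 <= u -> u * turan nu u < besselRatio nu u.
Proof.
  intros hnu hu.
  assert (h : 0 < 1 - nu * besselRatio nu u - u * besselRatio nu u ^ 2).
  2:{ pose proof (turan_riccati nu u hnu hu); lra. }
  revert u hu.
  apply (barrier _ (fun u => nu * turan nu u + 2 * u * besselRatio nu u * turan nu u
     - besselRatio nu u ^ 2)).
  - rewrite besselRatio_0 by exact hnu.
    replace (1 - _ - _) with (/ (nu + 1)) by (field; lra).
    apply Rinv_0_lt_compat; lra.
  - intros t ht; eapply is_derive_cont.
    pose proof (is_derive_besselRatio nu t hnu ht) as hd.
    auto_derive; [repeat split; eexists; exact hd | reflexivity].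
  - intros t ht e; split.
    + pose proof (is_derive_besselRatio nu t hnu (Rlt_le _ _ ht)) as hd.
      auto_derive; [repeat split; eexists; exact hd|].
      rewrite (Derive_of_is_derive (besselRatio nu) _ _ hd); ring.
    + pose proof (turan_riccati nu t hnu (Rlt_le _ _ ht)) as e'.
      pose proof (turan_pos nu t hnu (Rlt_le _ _ ht)) as hT.
      replace (besselRatio nu t) with (t * turan nu t) by lra.
      replace (_ - _) with (turan nu t * (nu + t ^ 2 * turan nu t)) by ring.
      apply Rmult_lt_0_compat; [exact hT|].
      assert (0 < t ^ 2 * turan nu t) by (apply Rmult_lt_0_compat; [apply pow_lt|]; assumption).
      lra.
Qed.

(** * Strict monotonicity and range of the critical parameter *)

Lemma criticalParam_0 (nu : R) : 0 <= nu -> criticalParam nu 0 = 2.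
Proof.
  intros hnu; unfold criticalParam; rewrite turan_0, besselRatio_0 by exact hnu.
  field; repeat split; lra.
Qed.

Lemma continuity_criticalParam (nu u : R) : 0 <= nu -> 0 <= u ->
  continuity_pt (criticalParam nu) u.
Proof.
  intros hnu hu.
  pose proof (is_derive_cont _ _ _ (is_derive_besselRatio nu u hnu hu)) as hg.
  pose proof (turan_pos nu u hnu hu).
  apply (continuity_pt_minus (fun v => besselRatio nu v ^ 2 / turan nu v
     - 2 * v * besselRatio nu v) (fun _ => nu)).
  - apply (continuity_pt_minus (fun v => besselRatio nu v ^ 2 / turan nu v)
      (fun v => 2 * v * besselRatio nu v)).
    + apply (continuity_pt_div (fun v => besselRatio nu v ^ 2) (turan nu));
        [|now apply continuity_turan | lra].
      apply (continuity_pt_comp (besselRatio nu) (fun y => y ^ 2)); [exact hg|].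
      apply derivable_continuous_pt, derivable_pt_pow.
    + apply (continuity_pt_mult (fun v => 2 * v) (besselRatio nu)); [|exact hg].
      apply (is_derive_cont _ _ 2); auto_derive; [exact I | ring].
  - apply continuity_pt_const; intros x y; reflexivity.
Qed.

Lemma is_derive_criticalParam (nu u : R) : 0 <= nu -> 0 < u ->
  is_derive (criticalParam nu) u
    (besselRatio nu u ^ 2 / turan nu u
     * (2 * (1 - relTuran nu u) ^ 2 - criticalParam nu u) / u).
Proof.
  intros hnu hu.
  pose proof (is_derive_besselRatio nu u hnu (Rlt_le _ _ hu)) as hg.
  pose proof (is_derive_turan nu u hnu hu) as hT.
  pose proof (besselRatio_pos nu u hnu (Rlt_le _ _ hu)) as g0.
  pose proof (turan_pos nu u hnu (Rlt_le _ _ hu)) as T0.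
  unfold criticalParam at 1.
  auto_derive.
  - repeat split; [eexists; exact hg | eexists; exact hT | lra | eexists; exact hg].
  - rewrite (Derive_of_is_derive (besselRatio nu) _ _ hg).
    rewrite (Derive_of_is_derive (turan nu) _ _ hT).
    unfold relTuran, criticalParam; field; repeat split; lra.
Qed.

Lemma is_derive_relTuran (nu u : R) : 0 <= nu -> 0 < u ->
  is_derive (relTuran nu) u
    (relTuran nu u * (criticalParam nu u - 1 + relTuran nu u) / u).
Proof.
  intros hnu hu.
  pose proof (is_derive_besselRatio nu u hnu (Rlt_le _ _ hu)) as hg.
  pose proof (is_derive_turan nu u hnu hu) as hT.
  pose proof (besselRatio_pos nu u hnu (Rlt_le _ _ hu)) as g0.
  pose proof (turan_pos nu u hnu (Rlt_le _ _ hu)) as T0.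
  unfold relTuran at 1.
  auto_derive.
  - repeat split; [eexists; exact hT | eexists; exact hg | lra].
  - rewrite (Derive_of_is_derive (besselRatio nu) _ _ hg).
    rewrite (Derive_of_is_derive (turan nu) _ _ hT).
    unfold relTuran, criticalParam; field; repeat split; lra.
Qed.

Lemma is_derive_profile (nu lam u : R) : 0 <= nu -> 0 < u ->
  is_derive (profile nu lam) u (turan nu u * (criticalParam nu u - lam)).
Proof.
  intros hnu hu.
  pose proof (is_derive_besselRatio nu u hnu (Rlt_le _ _ hu)) as hg.
  pose proof (turan_pos nu u hnu (Rlt_le _ _ hu)) as T0.
  unfold profile; auto_derive.
  - repeat split; eexists; exact hg.
  - rewrite (Derive_of_is_derive (besselRatio nu) _ _ hg).
    unfold criticalParam; field; lra.
Qed.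

Lemma relTuran_bounds (nu u : R) : 0 <= nu -> 0 < u -> 0 < relTuran nu u < 1.
Proof.
  intros hnu hu; unfold relTuran.
  pose proof (besselRatio_pos nu u hnu (Rlt_le _ _ hu)) as g0.
  pose proof (turan_pos nu u hnu (Rlt_le _ _ hu)) as T0.
  pose proof (turan_lt_ratio nu u hnu (Rlt_le _ _ hu)) as h.
  split.
  - apply Rdiv_lt_0_compat; [now apply Rmult_lt_0_compat | exact g0].
  - apply (Rmult_lt_reg_r (besselRatio nu u)); [exact g0|].
    unfold Rdiv; rewrite Rmult_assoc, Rinv_l by lra; lra.
Qed.

Lemma criticalParam_relTuran (nu u : R) : 0 <= nu -> 0 < u ->
  criticalParam nu u + nu =
  besselRatio nu u ^ 2 / turan nu u * (1 - 2 * relTuran nu u).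
Proof.
  intros hnu hu; unfold criticalParam, relTuran.
  pose proof (besselRatio_pos nu u hnu (Rlt_le _ _ hu)) as g0.
  pose proof (turan_pos nu u hnu (Rlt_le _ _ hu)) as T0.
  field; lra.
Qed.

(** The left side of [criticalParam_relTuran] is positive, hence so is [1 - 2 z]. *)
Lemma relTuran_lt_half (nu u : R) : 0 <= nu -> 0 < u ->
  0 < criticalParam nu u -> relTuran nu u < 1 / 2.
Proof.
  intros hnu hu hL.
  pose proof (criticalParam_relTuran nu u hnu hu) as e.
  pose proof (besselRatio_pos nu u hnu (Rlt_le _ _ hu)) as g0.
  pose proof (turan_pos nu u hnu (Rlt_le _ _ hu)) as T0.
  assert (hw : 0 < besselRatio nu u ^ 2 / turan nu u)
    by (apply Rdiv_lt_0_compat; [apply pow_lt|]; assumption).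
  nra.
Qed.

(** The right-hand side of the equation for [L'] is negative for all [u > 0].  A
    failure at [u] would propagate back to 0, because the region [M > 0] is
    forward invariant; [L] would then be nondecreasing on [(0, u]] and reach
    at least [L(0) = 2], where the inequality holds since [z < 1]. *)
Lemma criticalParam_above_nullcline (nu u : R) : 0 <= nu -> 0 < u ->
  2 * (1 - relTuran nu u) ^ 2 < criticalParam nu u.
Proof.
  intros hnu hu.
  set (M := fun v => criticalParam nu v - 2 * (1 - relTuran nu v) ^ 2).
  set (dM := fun v =>
    besselRatio nu v ^ 2 / turan nu v
     * (2 * (1 - relTuran nu v) ^ 2 - criticalParam nu v) / v
    + 4 * (1 - relTuran nu v)
      * (relTuran nu v * (criticalParam nu v - 1 + relTuran nu v) / v)).
  assert (hdM : forall v, 0 < v -> is_derive M v (dM v)).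
  { intros v hv; unfold M.
    pose proof (is_derive_criticalParam nu v hnu hv) as hL.
    pose proof (is_derive_relTuran nu v hnu hv) as hz.
    auto_derive.
    - repeat split; eexists; [exact hL | exact hz].
    - rewrite (Derive_of_is_derive (criticalParam nu) _ _ hL).
      rewrite (Derive_of_is_derive (relTuran nu) _ _ hz).
      unfold dM; ring. }
  assert (hstay : forall a b, 0 < a -> 0 < M a -> a <= b -> 0 < M b).
  { intros a b ha hMa; revert b; apply (barrier _ dM); [exact hMa| |].
    - intros t ht; eapply is_derive_cont, hdM; lra.
    - intros t ht hM; assert (ht0 : 0 < t) by lra.
      split; [now apply hdM|].
      destruct (relTuran_bounds nu t hnu ht0) as [z0 z1].
      unfold M in hM; unfold dM.
      replace (criticalParam nu t) with (2 * (1 - relTuran nu t) ^ 2) by lra.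
      assert (hL : 0 < criticalParam nu t).
      { replace (criticalParam nu t) with (2 * (1 - relTuran nu t) ^ 2) by lra.
        apply Rmult_lt_0_compat; [lra | apply pow_lt; lra]. }
      pose proof (relTuran_lt_half nu t hnu ht0 hL) as z2.
      set (z := relTuran nu t) in *.
      rewrite Rminus_diag, Rmult_0_r.
      replace (0 / t + _) with
        (4 * (1 - z) * (z * ((1 - z) * (1 - 2 * z)) / t)) by (field; lra).
      apply Rmult_lt_0_compat; [lra|].
      apply Rdiv_lt_0_compat; [|exact ht0].
      apply Rmult_lt_0_compat; [lra | apply Rmult_lt_0_compat; lra]. }
  destruct (Rlt_le_dec 0 (M u)) as [h|hMu]; [unfold M in h; lra|exfalso].
  destruct (mean_value (criticalParam nu) _ 0 u hu
    (fun c hc => continuity_criticalParam nu c hnu (proj1 hc))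
    (fun c hc => is_derive_criticalParam nu c hnu (proj1 hc))) as [c [[hc0 hcu] e]].
  assert (hMc : M c <= 0).
  { destruct (Rlt_le_dec 0 (M c)) as [h|h]; [|exact h].
    specialize (hstay c u hc0 h (Rlt_le _ _ hcu)); lra. }
  rewrite criticalParam_0 in e by exact hnu.
  assert (hL2 : 2 <= criticalParam nu u).
  { unfold M in hMc.
    pose proof (besselRatio_pos nu c hnu (Rlt_le _ _ hc0)) as g0.
    pose proof (turan_pos nu c hnu (Rlt_le _ _ hc0)) as T0.
    assert (hw : 0 <= besselRatio nu c ^ 2 / turan nu c
       * (2 * (1 - relTuran nu c) ^ 2 - criticalParam nu c) / c * (u - 0)).
    { apply Rmult_le_pos; [|lra]; apply Rmult_le_pos; [|left; now apply Rinv_0_lt_compat].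
      apply Rmult_le_pos; [|lra].
      left; apply Rdiv_lt_0_compat; [now apply pow_lt | exact T0]. }
    lra. }
  destruct (relTuran_bounds nu u hnu hu) as [z0 z1].
  unfold M in hMu; nra.
Qed.

Lemma criticalParam_gt_half (nu u : R) : 0 <= nu -> 0 < u -> 1 / 2 < criticalParam nu u.
Proof.
  intros hnu hu.
  pose proof (criticalParam_above_nullcline nu u hnu hu) as h.
  assert (hL : 0 < criticalParam nu u) by (pose proof (pow2_ge_0 (1 - relTuran nu u)); lra).
  pose proof (relTuran_lt_half nu u hnu hu hL); nra.
Qed.

Lemma criticalParam_decr (nu a b : R) : 0 <= nu -> 0 <= a -> a < b ->
  criticalParam nu b < criticalParam nu a.
Proof.
  intros hnu ha hab.
  destruct (mean_value (criticalParam nu) _ a b hab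
    (fun c hc => continuity_criticalParam nu c hnu ltac:(lra))
    (fun c hc => is_derive_criticalParam nu c hnu ltac:(lra))) as [c [hc e]].
  assert (hc0 : 0 < c) by lra.
  pose proof (criticalParam_above_nullcline nu c hnu hc0) as h.
  pose proof (besselRatio_pos nu c hnu (Rlt_le _ _ hc0)) as g0.
  pose proof (turan_pos nu c hnu (Rlt_le _ _ hc0)) as T0.
  assert (hw : 0 < besselRatio nu c ^ 2 / turan nu c
     * (criticalParam nu c - 2 * (1 - relTuran nu c) ^ 2) / c * (b - a)).
  { apply Rmult_lt_0_compat; [|lra]; apply Rdiv_lt_0_compat; [|exact hc0].
    apply Rmult_lt_0_compat; [|lra].
    apply Rdiv_lt_0_compat; [now apply pow_lt | exact T0]. }
  replace (2 * (1 - relTuran nu c) ^ 2 - criticalParam nu c)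
    with (- (criticalParam nu c - 2 * (1 - relTuran nu c) ^ 2)) in e by ring.
  unfold Rdiv in *; rewrite <- Ropp_mult_distr_r, <- !Ropp_mult_distr_l in e; lra.
Qed.

(** With [y = u g], positivity of [T] reads [y^2 + (nu + 1) y > u]. *)
Lemma ratio_large (nu K u : R) : 0 <= nu -> 0 < K -> K ^ 2 + (nu + 1) * K <= u ->
  K <= u * besselRatio nu u.
Proof.
  intros hnu hK hu.
  assert (hu0 : 0 < u) by nra.
  destruct (Rle_lt_dec K (u * besselRatio nu u)) as [h|h]; [exact h|exfalso].
  pose proof (besselRatio_pos nu u hnu (Rlt_le _ _ hu0)) as g0.
  pose proof (turan_pos nu u hnu (Rlt_le _ _ hu0)) as T0.
  pose proof (turan_riccati nu u hnu (Rlt_le _ _ hu0)) as e.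
  assert (0 < u * (u * turan nu u)) by (repeat apply Rmult_lt_0_compat; assumption).
  rewrite e in H.
  set (y := u * besselRatio nu u) in *.
  assert (0 < y) by (apply Rmult_lt_0_compat; assumption).
  replace (u * _) with (y ^ 2 + (nu + 1) * y - u) in H by (unfold y; ring).
  nra.
Qed.

(** If [L] stayed above [lam = 1/2 + d], then [z] would tend to [1/2] because
    [(g^2 / T) (1 - 2 z) = L + nu] is bounded while [u g], hence
    [g^2 / T], is unbounded.  For large [u] this gives
    [2 (1 - z)^2 - L <= - d/2] and [u L' <= - 3], so that [L] drops by at
    least [3/2] between [U] and [2 U], from below 2 to below [1/2]. *)
Lemma criticalParam_below (nu lam : R) : 0 <= nu -> 1 / 2 < lam ->
  exists u, 0 < u /\ criticalParam nu u < lam.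
Proof.
  intros hnu hlam.
  set (d := lam - 1 / 2); assert (hd : 0 < d) by (unfold d; lra).
  (* [K] is a size of [u g] beyond which both [3 (1 - 2 z) <= d] and
     [(g^2 / T) d / 2 >= 3]. *)
  set (K := 3 * (2 + nu) / (2 * d)).
  assert (hK : 0 < K) by (apply Rdiv_lt_0_compat; lra).
  set (U := K ^ 2 + (nu + 1) * K).
  assert (hU : 0 < U).
  { pose proof (pow_lt K 2 hK); pose proof (Rmult_lt_0_compat (nu + 1) K ltac:(lra) hK).
    unfold U; lra. }
  destruct (Rlt_le_dec (criticalParam nu U) lam) as [h|hL1]; [now exists U|].
  destruct (Rlt_le_dec (criticalParam nu (2 * U)) lam) as [h|hL2];
    [exists (2 * U); lra|exfalso].
  destruct (mean_value (criticalParam nu) _ U (2 * U) ltac:(lra)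
    (fun c hc => continuity_criticalParam nu c hnu ltac:(lra))
    (fun c hc => is_derive_criticalParam nu c hnu ltac:(lra))) as [c [hc e]].
  assert (hc0 : 0 < c) by lra.
  pose proof (ratio_large nu K c hnu hK ltac:(fold U; lra)) as hy.
  pose proof (criticalParam_decr nu c (2 * U) hnu (Rlt_le _ _ hc0) (proj2 hc)) as hLc.
  pose proof (criticalParam_decr nu 0 c hnu (Rle_refl _) hc0) as hLc2.
  pose proof (criticalParam_decr nu 0 U hnu (Rle_refl _) hU) as hLU.
  rewrite criticalParam_0 in hLc2, hLU by exact hnu.
  pose proof (relTuran_lt_half nu c hnu hc0 ltac:(lra)) as hz.
  pose proof (relTuran_bounds nu c hnu hc0) as [z0 z1].
  pose proof (criticalParam_relTuran nu c hnu hc0) as ew.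
  pose proof (besselRatio_pos nu c hnu (Rlt_le _ _ hc0)) as g0.
  pose proof (turan_pos nu c hnu (Rlt_le _ _ hc0)) as T0.
  assert (ey : c * besselRatio nu c =
     relTuran nu c * (besselRatio nu c ^ 2 / turan nu c))
    by (unfold relTuran; field; lra).
  set (w := besselRatio nu c ^ 2 / turan nu c) in *.
  set (z := relTuran nu c) in *.
  assert (hwy : 2 * K <= w) by nra.
  assert (hs : w * (1 - 2 * z) <= 2 + nu) by lra.
  assert (hKd : 2 * K * d = 3 * (2 + nu)) by (unfold K; field; lra).
  assert (hez : 3 * (1 - 2 * z) <= d).
  { apply (Rmult_le_reg_l (2 * K)); [lra|].
    rewrite hKd.
    assert (2 * K * (1 - 2 * z) <= w * (1 - 2 * z)) by (apply Rmult_le_compat_r; lra).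
    lra. }
  assert (hneg : 2 * (1 - z) ^ 2 - criticalParam nu c <= - (d / 2)).
  { unfold d in *; nra. }
  assert (hslope : w * (2 * (1 - z) ^ 2 - criticalParam nu c) <= - 3).
  { assert (w * (2 * (1 - z) ^ 2 - criticalParam nu c) <= w * (- (d / 2)))
      by (apply Rmult_le_compat_l; lra).
    assert (2 * K * d <= w * d) by (apply Rmult_le_compat_r; lra).
    lra. }
  set (s := w * (2 * (1 - z) ^ 2 - criticalParam nu c)) in *.
  assert (hq : s / c * (2 * U - U) <= - (3 / 2)).
  { replace (s / c * (2 * U - U)) with (s * (U / c)) by (field; lra).
    assert (hUc : / 2 <= U / c).
    { apply (Rmult_le_reg_r c); [exact hc0|].
      unfold Rdiv; rewrite Rmult_assoc, Rinv_l by lra; lra. }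
    nra. }
  lra.
Qed.

Lemma criticalParam_surj (nu lam : R) : 0 <= nu -> 1 / 2 < lam < 2 ->
  exists u, 0 < u /\ criticalParam nu u = lam.
Proof.
  intros hnu [h1 h2].
  destruct (criticalParam_below nu lam hnu h1) as [b [hb hLb]].
  destruct (IVT_interv (fun u => lam - criticalParam nu u) 0 b) as [u [hu e]].
  - intros a ha; apply (continuity_pt_minus (fun _ => lam) (criticalParam nu)).
    + apply continuity_pt_const; intros x y; reflexivity.
    + apply continuity_criticalParam; lra.
  - exact hb.
  - rewrite criticalParam_0 by exact hnu; lra.
  - lra.
  - exists u; split; [|lra].
    destruct (Req_dec u 0) as [->|ne]; [|lra].
    rewrite criticalParam_0 in e by exact hnu; lra.
Qed.

(** * The maximizer and the best coefficient *)

Definition criticalPoint (nu lam : R) : R :=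
  epsilon (inhabits 0) (fun u => 0 < u /\ criticalParam nu u = lam).

Lemma criticalPoint_spec (nu lam : R) : 0 <= nu -> 1 / 2 < lam < 2 ->
  0 < criticalPoint nu lam /\ criticalParam nu (criticalPoint nu lam) = lam.
Proof.
  intros hnu hlam.
  apply (epsilon_spec (inhabits 0) (fun u => 0 < u /\ criticalParam nu u = lam)).
  now apply criticalParam_surj.
Qed.

Lemma criticalParam_lt_inv (nu a b : R) : 0 <= nu -> 0 < a -> 0 < b ->
  criticalParam nu a < criticalParam nu b -> b < a.
Proof.
  intros hnu ha hb h.
  destruct (Rtotal_order a b) as [hab|[->|hab]]; [|lra|exact hab].
  pose proof (criticalParam_decr nu a b hnu (Rlt_le _ _ ha) hab); lra.
Qed.

(** The derivative [T (L - lam)] changes sign from plus to minus exactly once,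
    [L] being strictly decreasing. *)
Lemma profile_lt_max (nu lam u : R) : 0 <= nu -> 1 / 2 < lam < 2 -> 0 < u ->
  u <> criticalPoint nu lam ->
  profile nu lam u < profile nu lam (criticalPoint nu lam).
Proof.
  intros hnu hlam hu hne.
  destruct (criticalPoint_spec nu lam hnu hlam) as [hp e].
  set (p := criticalPoint nu lam) in *.
  assert (hc : forall v, 0 < v -> continuity_pt (profile nu lam) v)
    by (intros v hv; eapply is_derive_cont, is_derive_profile; assumption).
  destruct (Rlt_le_dec u p) as [hup|hpu].
  - destruct (mean_value (profile nu lam) _ u p hup
      (fun c h => hc c ltac:(lra))
      (fun c h => is_derive_profile nu lam c hnu ltac:(lra))) as [c [h e']].
    pose proof (criticalParam_decr nu c p hnu ltac:(lra) (proj2 h)).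
    pose proof (turan_pos nu c hnu ltac:(lra)).
    assert (0 < turan nu c * (criticalParam nu c - lam) * (p - u))
      by (apply Rmult_lt_0_compat; [apply Rmult_lt_0_compat|]; lra).
    lra.
  - destruct (mean_value (profile nu lam) _ p u ltac:(lra)
      (fun c h => hc c ltac:(lra))
      (fun c h => is_derive_profile nu lam c hnu ltac:(lra))) as [c [h e']].
    pose proof (criticalParam_decr nu p c hnu ltac:(lra) (proj1 h)).
    pose proof (turan_pos nu c hnu ltac:(lra)).
    assert (0 < turan nu c * (lam - criticalParam nu c) * (u - p))
      by (apply Rmult_lt_0_compat; [apply Rmult_lt_0_compat|]; lra).
    lra.
Qed.

Definition bestCoef (nu lam : R) : R := profile nu lam (criticalPoint nu lam).

Lemma profile_le_bestCoef (nu lam u : R) : 0 <= nu -> 1 / 2 < lam < 2 -> 0 < u ->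
  profile nu lam u <= bestCoef nu lam.
Proof.
  intros hnu hlam hu.
  destruct (Req_dec u (criticalPoint nu lam)) as [->|h]; [apply Rle_refl|].
  left; now apply profile_lt_max.
Qed.

Lemma profile_pos (nu lam u : R) : 0 <= nu -> 0 < lam -> 0 <= u -> 0 < profile nu lam u.
Proof.
  intros hnu hlam hu; unfold profile.
  pose proof (besselRatio_pos nu u hnu hu) as g0.
  pose proof (Rmult_le_pos _ _ hu (Rlt_le _ _ g0)).
  apply Rmult_lt_0_compat; lra.
Qed.

Lemma hI_besselRatio (nu x : R) : 0 <= nu -> 0 < x ->
  hI nu x = 2 / x * (nu + (x / 2) ^ 2 * besselRatio nu ((x / 2) ^ 2)).
Proof.
  intros hnu hx; rewrite hI_besselSum by exact hx; f_equal.
  rewrite besselSum_rec by exact hnu; unfold besselRatio.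
  pose proof (besselSum_pos nu ((x / 2) ^ 2) hnu (pow2_ge_0 _)); field; lra.
Qed.

(** With [q = nu + lam + 2 u g], the bound is [q] against the square root, and
    [(nu + lam)^2 + c x^2 = q^2 + x^2 (c - F_lam(u))]. *)
Lemma hI_UI_profile (nu c lam x : R) : 0 <= nu -> 0 < lam -> 0 < x ->
  (profile nu lam ((x / 2) ^ 2) = c -> hI nu x = UI nu c lam x) /\
  (profile nu lam ((x / 2) ^ 2) < c -> hI nu x < UI nu c lam x).
Proof.
  intros hnu hlam hx; unfold UI; rewrite hI_besselRatio by assumption.
  pose proof (besselRatio_pos nu ((x / 2) ^ 2) hnu (pow2_ge_0 _)) as g0.
  unfold profile; set (g := besselRatio nu ((x / 2) ^ 2)) in *.
  set (P := g * ((x / 2) ^ 2 * g + nu + lam)).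
  set (q := nu + lam + 2 * ((x / 2) ^ 2 * g)).
  assert (hq : 0 < q).
  { pose proof (Rmult_le_pos _ _ (pow2_ge_0 (x / 2)) (Rlt_le _ _ g0)); unfold q; lra. }
  replace ((nu + lam) ^ 2 + c * x ^ 2) with (q ^ 2 + x ^ 2 * (c - P))
    by (unfold q, P; field).
  replace (2 / x * (nu + (x / 2) ^ 2 * g)) with (1 / x * (nu - lam + q))
    by (unfold q; field; lra).
  rewrite <- (sqrt_pow2 q) at 1 3 by lra.
  split; intros h.
  - do 2 f_equal; f_equal; rewrite h; ring.
  - apply Rmult_lt_compat_l; [apply Rdiv_lt_0_compat; lra|].
    apply Rplus_lt_compat_l, sqrt_lt_1_alt; split; [apply pow2_ge_0|].
    pose proof (Rmult_lt_0_compat (x ^ 2) (c - P) (pow_lt _ 2 hx) ltac:(lra)); lra.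
Qed.

Lemma ex_derive_hI (nu x : R) : 0 <= nu -> 0 < x -> ex_derive (hI nu) x.
Proof.
  intros hnu hx.
  apply (ex_derive_ext_loc
    (fun t => 2 / t * (nu + (t / 2) ^ 2 * besselRatio nu ((t / 2) ^ 2)))).
  - exists (mkposreal x hx); intros t ht; symmetry; apply hI_besselRatio; [exact hnu|].
    apply Rabs_def2 in ht; unfold minus, plus, opp in ht; simpl in ht; lra.
  - auto_derive; repeat split; [lra|].
    eexists; apply is_derive_besselRatio; [exact hnu | apply pow2_ge_0].
Qed.

Lemma ex_derive_UI (nu c lam x : R) : 0 <= nu -> 0 < lam -> 0 < c -> 0 < x ->
  ex_derive (UI nu c lam) x.
Proof.
  intros hnu hlam hc hx; unfold UI; auto_derive; repeat split; [lra|].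
  pose proof (pow_lt (nu + lam) 2 ltac:(lra)).
  pose proof (Rmult_lt_0_compat c (x ^ 2) hc (pow_lt _ 2 hx)).
  simpl in *; lra.
Qed.

Lemma Derive_eq_of_touching (f g : R -> R) (a x : R) : a < x ->
  ex_derive f x -> ex_derive g x -> f x = g x ->
  (forall t, a < t -> f t <= g t) -> Derive f x = Derive g x.
Proof.
  intros hax hf hg e hle.
  assert (pr : derivable_pt (fun t => g t - f t) x).
  { apply ex_derive_Reals_0; now apply (ex_derive_minus g f). }
  assert (h0 : derive_pt (fun t => g t - f t) x pr = 0).
  { apply (deriv_minimum _ a (x + 1)); [exact hax | lra|].
    intros t ht _; specialize (hle t ht); lra. }
  rewrite Derive_Reals, Derive_minus in h0 by assumption; lra.
Qed.

(** * Dependence on the parameter *)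

Lemma at_right_interval (a b : R) (P : R -> Prop) : a < b ->
  (forall t, a < t < b -> P t) -> at_right a P.
Proof.
  intros hab h; exists (mkposreal (b - a) ltac:(lra)); intros t ht hat.
  apply h; apply Rabs_def2 in ht; unfold minus, plus, opp in ht; simpl in ht; lra.
Qed.

Lemma at_left_interval (a b : R) (P : R -> Prop) : a < b ->
  (forall t, a < t < b -> P t) -> at_left b P.
Proof.
  intros hab h; exists (mkposreal (b - a) ltac:(lra)); intros t ht hat.
  apply h; apply Rabs_def2 in ht; unfold minus, plus, opp in ht; simpl in ht; lra.
Qed.

(** The lower bound is [u T >= 0], the upper bound is [u T < g]. *)
Lemma profile_near_1 (nu lam u : R) : 0 <= nu -> 0 < lam -> 0 <= u ->
  1 + (lam - 1) * besselRatio nu u <= profile nu lam u <= 1 + lam * besselRatio nu u.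
Proof.
  intros hnu hlam hu; unfold profile.
  pose proof (turan_riccati nu u hnu hu).
  pose proof (turan_lt_ratio nu u hnu hu).
  pose proof (Rmult_le_pos _ _ hu (Rlt_le _ _ (turan_pos nu u hnu hu))).
  lra.
Qed.

(** From [u T < g], that is [u g^2 < 1 - nu g]. *)
Lemma besselRatio_small (nu e u : R) : 0 <= nu -> 0 < e -> / e ^ 2 <= u ->
  besselRatio nu u < e.
Proof.
  intros hnu he hu.
  assert (he2 : 0 < / e ^ 2) by (apply Rinv_0_lt_compat, pow_lt, he).
  assert (hu0 : 0 <= u) by lra.
  pose proof (besselRatio_pos nu u hnu hu0) as g0.
  pose proof (turan_riccati nu u hnu hu0).
  pose proof (turan_lt_ratio nu u hnu hu0).
  destruct (Rlt_le_dec (besselRatio nu u) e) as [h|h]; [exact h|exfalso].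
  assert (e ^ 2 <= besselRatio nu u ^ 2) by (apply pow_incr; lra).
  assert (/ e ^ 2 * e ^ 2 <= u * besselRatio nu u ^ 2)
    by (apply Rmult_le_compat; [lra | apply pow2_ge_0 | exact hu | assumption]).
  rewrite Rinv_l in * by (apply pow_nonzero; lra).
  pose proof (Rmult_le_pos _ _ hnu (Rlt_le _ _ g0)); lra.
Qed.

Lemma profile_0 (nu lam : R) : 0 <= nu -> profile nu lam 0 = (nu + lam) / (nu + 1).
Proof.
  intros hnu; unfold profile; rewrite besselRatio_0 by exact hnu; field; lra.
Qed.

Lemma continuity_profile (nu lam u : R) : 0 <= nu -> 0 <= u ->
  continuity_pt (profile nu lam) u.
Proof.
  intros hnu hu; pose proof (is_derive_besselRatio nu u hnu hu) as hg.
  eapply is_derive_cont; unfold profile; auto_derive;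
    [repeat split; eexists; exact hg | reflexivity].
Qed.

(** The bounds are [F_lam(0)] and [F_2(0)]: [F_lam] increases up to its maximizer,
    it increases with [lam], and [F_2] is decreasing because [L < 2]. *)
Lemma bestCoef_bounds (nu lam : R) : 0 <= nu -> 1 / 2 < lam < 2 ->
  (nu + lam) / (nu + 1) < bestCoef nu lam < (nu + 2) / (nu + 1).
Proof.
  intros hnu hlam.
  destruct (criticalPoint_spec nu lam hnu hlam) as [hp e].
  unfold bestCoef; set (p := criticalPoint nu lam) in *.
  split.
  - rewrite <- profile_0 by exact hnu.
    destruct (mean_value (profile nu lam) _ 0 p hp
      (fun c h => continuity_profile nu lam c hnu (proj1 h))
      (fun c h => is_derive_profile nu lam c hnu (proj1 h))) as [c [h e']].
    pose proof (criticalParam_decr nu c p hnu ltac:(lra) (proj2 h)).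
    pose proof (turan_pos nu c hnu ltac:(lra)).
    assert (0 < turan nu c * (criticalParam nu c - lam) * (p - 0))
      by (apply Rmult_lt_0_compat; [apply Rmult_lt_0_compat|]; lra).
    lra.
  - apply Rlt_trans with (profile nu 2 p).
    + unfold profile; apply Rmult_lt_compat_l; [apply besselRatio_pos; lra | lra].
    + rewrite <- profile_0 by exact hnu.
      destruct (mean_value (profile nu 2) _ 0 p hp
        (fun c h => continuity_profile nu 2 c hnu (proj1 h))
        (fun c h => is_derive_profile nu 2 c hnu (proj1 h))) as [c [h e']].
      pose proof (criticalParam_decr nu 0 c hnu (Rle_refl 0) (proj1 h)) as hL.
      rewrite criticalParam_0 in hL by exact hnu.
      pose proof (turan_pos nu c hnu ltac:(lra)).
      assert (0 < turan nu c * (2 - criticalParam nu c) * (p - 0))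
        by (apply Rmult_lt_0_compat; [apply Rmult_lt_0_compat|]; lra).
      lra.
Qed.

Lemma criticalPoint_gt (nu lam v : R) : 0 <= nu -> 1 / 2 < lam < 2 -> 0 < v ->
  lam < criticalParam nu v -> v < criticalPoint nu lam.
Proof.
  intros hnu hlam hv h.
  destruct (criticalPoint_spec nu lam hnu hlam) as [hp e].
  apply (criticalParam_lt_inv nu); try assumption; lra.
Qed.

Lemma criticalPoint_lt (nu lam v : R) : 0 <= nu -> 1 / 2 < lam < 2 -> 0 < v ->
  criticalParam nu v < lam -> criticalPoint nu lam < v.
Proof.
  intros hnu hlam hv h.
  destruct (criticalPoint_spec nu lam hnu hlam) as [hp e].
  apply (criticalParam_lt_inv nu); try assumption; lra.
Qed.

Lemma criticalPoint_large (nu K : R) : 0 <= nu -> 0 < K ->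
  exists b, 1 / 2 < b < 2 /\ forall lam, 1 / 2 < lam < b -> K < criticalPoint nu lam.
Proof.
  intros hnu hK; exists (criticalParam nu K).
  assert (hb : 1 / 2 < criticalParam nu K < 2).
  { split; [now apply criticalParam_gt_half|].
    rewrite <- (criticalParam_0 nu hnu); apply criticalParam_decr; lra. }
  split; [exact hb|]; intros lam hlam; apply criticalPoint_gt; lra.
Qed.

Lemma criticalPoint_small (nu d : R) : 0 <= nu -> 0 < d ->
  exists b, 1 / 2 < b < 2 /\ forall lam, b < lam < 2 -> criticalPoint nu lam < d.
Proof.
  intros hnu hd; exists (criticalParam nu d).
  assert (hb : 1 / 2 < criticalParam nu d < 2).
  { split; [now apply criticalParam_gt_half|].
    rewrite <- (criticalParam_0 nu hnu); apply criticalParam_decr; lra. }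
  split; [exact hb|]; intros lam hlam; apply criticalPoint_lt; lra.
Qed.

Definition touchPoint (nu lam : R) : R := 2 * sqrt (criticalPoint nu lam).

Lemma bestCoef_pos (nu lam : R) : 0 <= nu -> 1 / 2 < lam < 2 -> 0 < bestCoef nu lam.
Proof.
  intros hnu hlam; destruct (criticalPoint_spec nu lam hnu hlam) as [hp _].
  apply profile_pos; lra.
Qed.

Lemma touchPoint_spec (nu lam : R) : 0 <= nu -> 1 / 2 < lam < 2 ->
  0 < touchPoint nu lam /\
  forall x, 0 < x -> (criticalPoint nu lam = (x / 2) ^ 2 <-> x = touchPoint nu lam).
Proof.
  intros hnu hlam; destruct (criticalPoint_spec nu lam hnu hlam) as [hp _].
  pose proof (sqrt_lt_R0 _ hp); unfold touchPoint; split; [lra|].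
  intros x hx; split; intros h.
  - rewrite h, sqrt_pow2; lra.
  - rewrite h; replace (2 * _ / 2) with (sqrt (criticalPoint nu lam)) by field.
    now rewrite pow2_sqrt by lra.
Qed.

Lemma bestCoef_tangent (nu lam : R) : 0 <= nu -> 1 / 2 < lam < 2 ->
  (forall x, 0 < x -> hI nu x <= UI nu (bestCoef nu lam) lam x) /\
  (forall x, 0 < x -> (hI nu x = UI nu (bestCoef nu lam) lam x <-> x = touchPoint nu lam)).
Proof.
  intros hnu hlam.
  destruct (touchPoint_spec nu lam hnu hlam) as [_ hx0].
  assert (h : forall x, 0 < x ->
    (x = touchPoint nu lam -> hI nu x = UI nu (bestCoef nu lam) lam x) /\
    (x <> touchPoint nu lam -> hI nu x < UI nu (bestCoef nu lam) lam x)).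
  { intros x hx; destruct (hI_UI_profile nu (bestCoef nu lam) lam x hnu ltac:(lra) hx) as [he hl].
    split; intros h; [apply he | apply hl].
    - apply (hx0 x hx) in h; unfold bestCoef; now rewrite h.
    - apply profile_lt_max; [assumption.. | nra |].
      intros e; apply h; apply (hx0 x hx); now symmetry. }
  split; intros x hx; destruct (h x hx) as [he hl];
    destruct (Req_dec x (touchPoint nu lam)) as [e|ne].
  - right; now apply he.
  - left; now apply hl.
  - tauto.
  - specialize (hl ne); split; intros; [lra | contradiction].
Qed.

(** [profile] is increasing in [lam] at the maximizer for [lam1]. *)
Lemma bestCoef_incr (nu lam1 lam2 : R) : 0 <= nu ->
  1 / 2 < lam1 -> lam1 < lam2 -> lam2 < 2 -> bestCoef nu lam1 < bestCoef nu lam2.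
Proof.
  intros hnu h1 h12 h2.
  destruct (criticalPoint_spec nu lam1 hnu ltac:(lra)) as [hp _].
  apply Rlt_le_trans with (profile nu lam2 (criticalPoint nu lam1)).
  - unfold bestCoef, profile.
    apply Rmult_lt_compat_l; [apply besselRatio_pos; lra | lra].
  - apply profile_le_bestCoef; lra.
Qed.

Lemma touchPoint_decr (nu lam1 lam2 : R) : 0 <= nu ->
  1 / 2 < lam1 -> lam1 < lam2 -> lam2 < 2 -> touchPoint nu lam2 < touchPoint nu lam1.
Proof.
  intros hnu h1 h12 h2.
  destruct (criticalPoint_spec nu lam1 hnu ltac:(lra)) as [hp1 e1].
  destruct (criticalPoint_spec nu lam2 hnu ltac:(lra)) as [hp2 _].
  apply Rmult_lt_compat_l; [lra|]; apply sqrt_lt_1_alt; split; [lra|].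
  apply criticalPoint_lt; lra.
Qed.

Lemma bestCoef_lim_half (nu : R) : 0 <= nu ->
  filterlim (bestCoef nu) (at_right (1 / 2)) (locally 1).
Proof.
  intros hnu; apply filterlim_locally; intros [eps heps].
  destruct (criticalPoint_large nu (/ (eps / 2) ^ 2) hnu) as [b [hb h]].
  { apply Rinv_0_lt_compat, pow_lt; lra. }
  apply (at_right_interval _ b); [lra|]; intros lam hlam.
  destruct (criticalPoint_spec nu lam hnu ltac:(lra)) as [hp _].
  pose proof (besselRatio_small nu (eps / 2) _ hnu ltac:(lra) (Rlt_le _ _ (h lam hlam))).
  pose proof (besselRatio_pos nu _ hnu (Rlt_le _ _ hp)).
  pose proof (profile_near_1 nu lam _ hnu ltac:(lra) (Rlt_le _ _ hp)).
  fold (bestCoef nu lam) in *.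
  change (Rabs (bestCoef nu lam - 1) < eps); apply Rabs_def1; nra.
Qed.

Lemma bestCoef_lim_2 (nu : R) : 0 <= nu ->
  filterlim (bestCoef nu) (at_left 2) (locally ((nu + 2) / (nu + 1))).
Proof.
  intros hnu; apply filterlim_locally; intros [eps heps].
  pose proof (Rmax_l (1 / 2) (2 - eps)); pose proof (Rmax_r (1 / 2) (2 - eps)).
  pose proof (Rmax_lub_lt (1 / 2) (2 - eps) 2 ltac:(lra) ltac:(lra)).
  apply (at_left_interval (Rmax (1 / 2) (2 - eps))); [assumption|]; intros lam hlam.
  pose proof (bestCoef_bounds nu lam hnu ltac:(lra)) as hC.
  assert ((nu + 2) / (nu + 1) - (nu + lam) / (nu + 1) <= 2 - lam).
  { replace (_ - _) with ((2 - lam) * / (nu + 1)) by (field; lra).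
    rewrite <- (Rmult_1_r (2 - lam)) at 2; apply Rmult_le_compat_l; [lra|].
    apply Rle_trans with (/ 1); [apply Rinv_le_contravar; lra | rewrite Rinv_1; lra]. }
  change (Rabs (bestCoef nu lam - (nu + 2) / (nu + 1)) < eps); apply Rabs_def1; lra.
Qed.

Lemma touchPoint_lim_half (nu : R) : 0 <= nu ->
  filterlim (touchPoint nu) (at_right (1 / 2)) (Rbar_locally p_infty).
Proof.
  intros hnu P [M hM]; unfold filtermap.
  pose proof (Rle_abs M); pose proof (Rabs_pos M).
  assert (hK : 0 < Rabs M + 1) by lra.
  destruct (criticalPoint_large nu ((Rabs M + 1) ^ 2) hnu (pow_lt _ 2 hK)) as [b [hb h]].
  apply (at_right_interval _ b); [lra|]; intros lam hlam; apply hM.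
  pose proof (sqrt_lt_1_alt _ _ (conj (pow2_ge_0 _) (h lam hlam))) as hs.
  rewrite sqrt_pow2 in hs by lra; unfold touchPoint; lra.
Qed.

Lemma touchPoint_lim_2 (nu : R) : 0 <= nu ->
  filterlim (touchPoint nu) (at_left 2) (locally 0).
Proof.
  intros hnu; apply filterlim_locally; intros [eps heps].
  destruct (criticalPoint_small nu ((eps / 2) ^ 2) hnu ltac:(apply pow_lt; lra)) as [b [hb h]].
  apply (at_left_interval b); [lra|]; intros lam hlam.
  destruct (criticalPoint_spec nu lam hnu ltac:(lra)) as [hp _].
  pose proof (sqrt_lt_1_alt _ _ (conj (Rlt_le _ _ hp) (h lam hlam))) as hs.
  rewrite sqrt_pow2 in hs by lra.
  pose proof (sqrt_pos (criticalPoint nu lam)).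
  change (Rabs (touchPoint nu lam - 0) < eps); unfold touchPoint; apply Rabs_def1; lra.
Qed.

Theorem theorem12 (nu : R) (hnu : 0 <= nu) :
  exists C xs : R -> R,
    (forall lam : R, 1 / 2 < lam < 2 ->
       0 < C lam /\
       (forall x : R, 0 < x -> hI nu x <= UI nu (C lam) lam x) /\
       0 < xs lam /\
       (forall x : R, 0 < x -> (hI nu x = UI nu (C lam) lam x <-> x = xs lam)) /\
       ex_derive (hI nu) (xs lam) /\
       ex_derive (UI nu (C lam) lam) (xs lam) /\
       Derive (hI nu) (xs lam) = Derive (UI nu (C lam) lam) (xs lam)) /\
    (forall lam1 lam2 : R, 1 / 2 < lam1 -> lam1 < lam2 -> lam2 < 2 ->
       C lam1 < C lam2 /\ xs lam2 < xs lam1) /\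
    filterlim C (at_right (1 / 2)) (locally 1) /\
    filterlim C (at_left 2) (locally ((nu + 2) / (nu + 1))) /\
    filterlim xs (at_right (1 / 2)) (Rbar_locally p_infty) /\
    filterlim xs (at_left 2) (locally 0).
Proof.
  exists (bestCoef nu), (touchPoint nu).
  split; [|split; [|repeat split]].
  - intros lam hlam.
    pose proof (bestCoef_pos nu lam hnu hlam) as hC.
    destruct (touchPoint_spec nu lam hnu hlam) as [hx _].
    destruct (bestCoef_tangent nu lam hnu hlam) as [hle heq].
    pose proof (ex_derive_hI nu _ hnu hx) as dh.
    pose proof (ex_derive_UI nu (bestCoef nu lam) lam _ hnu ltac:(lra) hC hx) as dU.
    repeat (split; [assumption|]).
    apply (Derive_eq_of_touching _ _ 0); try assumption.
    now apply heq.
  - intros lam1 lam2 h1 h12 h2; split; [now apply bestCoef_incr | now apply touchPoint_decr].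
  - now apply bestCoef_lim_half.
  - now apply bestCoef_lim_2.
  - now apply touchPoint_lim_half.
  - now apply touchPoint_lim_2.
Qed.
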